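(* (a) $F^4+FG+G^4=0$. (b) $D^3=G$.
   Context: In $\mathbb{Z}/2[[x]]$: $F=\sum_{n>0,\ n\text{ odd}}x^{n^2}$, $G=F(x^3)$, and $D=\sum_{n>0,\ \gcd(n,6)=1}x^{n^2}$. *)

(* Defs.v *)
From HB Require Import structures.
From mathcomp Require Import all_boot all_order all_algebra.
From mathcomp Require Import boolp.

Set Implicit Arguments.
Unset Strict Implicit.
Unset Printing Implicit Defensive.

Import GRing.Theory.
Local Open Scope ring_scope.

Record fps (R : Type) := FPS { fps_coef : nat -> R }.

HB.instance Definition _ (R : Type) := gen_eqMixin (fps R).
HB.instance Definition _ (R : Type) := gen_choiceMixin (fps R).

Lemma fpsP (R : Type) (f g : fps R) :
  (forall n, fps_coef f n = fps_coef g n) -> f = g.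
Proof. by case: f g => [f] [g] /= /funext->. Qed.

Definition fps_zero (R : zmodType) : fps R := FPS (fun=> 0).
Definition fps_opp (R : zmodType) (f : fps R) : fps R :=
  FPS (fun n => - fps_coef f n).
Definition fps_add (R : zmodType) (f g : fps R) : fps R :=
  FPS (fun n => fps_coef f n + fps_coef g n).

Lemma fps_addA (R : zmodType) : associative (@fps_add R).
Proof. by move=> f g h; apply: fpsP => n /=; rewrite addrA. Qed.
Lemma fps_addC (R : zmodType) : commutative (@fps_add R).
Proof. by move=> f g; apply: fpsP => n /=; rewrite addrC. Qed.
Lemma fps_add0 (R : zmodType) : left_id (fps_zero R) (@fps_add R).
Proof. by move=> f; apply: fpsP => n /=; rewrite add0r. Qed.
Lemma fps_addN (R : zmodType) :
  left_inverse (fps_zero R) (@fps_opp R) (@fps_add R).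
Proof. by move=> f; apply: fpsP => n /=; rewrite addNr. Qed.

HB.instance Definition _ (R : zmodType) := GRing.isZmodule.Build (fps R)
  (@fps_addA R) (@fps_addC R) (@fps_add0 R) (@fps_addN R).

Definition fpsC (R : nzRingType) (c : R) : fps R :=
  FPS (fun n => if n == 0%N then c else 0).
Definition fpsX (R : nzRingType) : fps R := FPS (fun n => (n == 1%N)%:R).
Definition fps_mul (R : nzRingType) (f g : fps R) : fps R :=
  FPS (fun n => \sum_(i < n.+1) fps_coef f i * fps_coef g (n - i)%N).

Definition fps_trunc (R : nzRingType) (N : nat) (f : fps R) : {poly R} :=
  \poly_(i < N) fps_coef f i.

Lemma coef_fps_trunc (R : nzRingType) (N : nat) (f : fps R) (n : nat) :
  (n < N)%N -> (fps_trunc N f)`_n = fps_coef f n.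
Proof. by move=> nN; rewrite coef_poly nN. Qed.

Lemma fps_mul_trunc (R : nzRingType) (N : nat) (f g : fps R) (n : nat) :
  (n < N)%N ->
  fps_coef (fps_mul f g) n = (fps_trunc N f * fps_trunc N g)`_n.
Proof.
move=> nN; rewrite coefM; apply: eq_bigr => i _.
rewrite !coef_fps_trunc //; first by apply: leq_ltn_trans nN; exact: leq_subr.
by apply: leq_ltn_trans nN; rewrite -ltnS.
Qed.

Lemma fps_mulA (R : comNzRingType) : associative (@fps_mul R).
Proof.
move=> f g h; apply: fpsP => n.
have lt_n (i : 'I_n.+1) : (n - i < n.+1)%N by rewrite ltnS leq_subr.
transitivity ((fps_trunc n.+1 f * (fps_trunc n.+1 g * fps_trunc n.+1 h))`_n).
  rewrite coefM; apply: eq_bigr => i _.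
  by rewrite coef_fps_trunc // -fps_mul_trunc.
rewrite mulrA coefM; apply: eq_bigr => i _.
by rewrite coef_fps_trunc // -fps_mul_trunc.
Qed.

Lemma fps_mulC (R : comNzRingType) : commutative (@fps_mul R).
Proof.
by move=> f g; apply: fpsP => n; rewrite !(fps_mul_trunc _ _ (ltnSn n)) mulrC.
Qed.

Lemma fps_mul1 (R : comNzRingType) : left_id (fpsC 1) (@fps_mul R).
Proof.
move=> f; apply: fpsP => n /=; rewrite big_ord_recl /= mul1r subn0.
by rewrite big1 ?addr0 // => i _; rewrite /bump mul0r.
Qed.

Lemma fps_mulDl (R : comNzRingType) :
  left_distributive (@fps_mul R) (@fps_add R).
Proof.
move=> f g h; apply: fpsP => n /=; rewrite -big_split.
by apply: eq_bigr => i _; rewrite mulrDl.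
Qed.

Lemma fps_oner_neq0 (R : comNzRingType) : fpsC 1 != 0 :> fps R.
Proof.
by apply/eqP => /(congr1 (fun f => fps_coef f 0%N)) /= /eqP; rewrite oner_eq0.
Qed.

HB.instance Definition _ (R : comNzRingType) :=
  GRing.Zmodule_isComNzRing.Build (fps R) (@fps_mulA R) (@fps_mulC R)
    (@fps_mul1 R) (@fps_mulDl R) (@fps_oner_neq0 R).

Lemma coef_fps0 (R : zmodType) (n : nat) : fps_coef (0 : fps R) n = 0.
Proof. by []. Qed.

Lemma coef_fps1 (R : comNzRingType) (n : nat) :
  fps_coef (1 : fps R) n = (n == 0%N)%:R.
Proof. by rewrite /=; case: eqP. Qed.

Lemma coef_fpsD (R : zmodType) (f g : fps R) (n : nat) :
  fps_coef (f + g) n = fps_coef f n + fps_coef g n.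
Proof. by []. Qed.

Lemma coef_fpsM (R : comNzRingType) (f g : fps R) (n : nat) :
  fps_coef (f * g) n = \sum_(i < n.+1) fps_coef f i * fps_coef g (n - i)%N.
Proof. by []. Qed.

Lemma coef_fps_sum (R : zmodType) (I : Type) (r : seq I) (P : pred I)
    (u : I -> fps R) (n : nat) :
  fps_coef (\sum_(i <- r | P i) u i) n = \sum_(i <- r | P i) fps_coef (u i) n.
Proof. exact: (big_morph (fun f : fps R => fps_coef f n)). Qed.

Lemma coef_fpsXM (R : comNzRingType) (f : fps R) (n : nat) :
  fps_coef (fpsX R * f) n = if n is m.+1 then fps_coef f m else 0.
Proof.
rewrite coef_fpsM big_ord_recl /= mul0r add0r.
case: n => [|n]; first by rewrite big_ord0.
rewrite big_ord_recl /= mul1r subn1 big1 ?addr0 // => i _.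
by rewrite /bump /= mul0r.
Qed.

Lemma coef_fpsXn (R : comNzRingType) (k n : nat) :
  fps_coef (fpsX R ^+ k) n = (n == k)%:R.
Proof.
elim: k n => [|k IHk] n; first by rewrite expr0 coef_fps1.
by rewrite exprS coef_fpsXM; case: n => // n; rewrite IHk.
Qed.

(* The infinite sum of the u n. The coefficient of x^m only sees the terms
   n <= m, so this is the x-adic limit of the partial sums when u n is divisible
   by x^n for every n (see fps_seriesP); it is not meaningful otherwise. *)
Definition fps_series (R : zmodType) (u : nat -> fps R) : fps R :=
  FPS (fun m => \sum_(n < m.+1) fps_coef (u n) m).

Lemma fps_seriesP (R : zmodType) (u : nat -> fps R) :
  (forall n i, (i < n)%N -> fps_coef (u n) i = 0) ->
  forall m N, (m < N)%N ->
  fps_coef (fps_series u) m = fps_coef (\sum_(n < N) u n) m.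
Proof.
move=> u_ord m N mN; rewrite coef_fps_sum /=.
rewrite -(big_mkord xpredT (fun n => fps_coef (u n) m)).
rewrite -(big_mkord xpredT (fun n => fps_coef (u n) m)).
rewrite [RHS](big_cat_nat (n := m.+1)) //=.
rewrite [X in _ + X]big_nat [X in _ + X]big1 ?addr0 // => n /andP[mn _].
exact: u_ord.
Qed.

(* The composite f(g), for g with zero constant term. *)
Definition fps_comp (R : comNzRingType) (f g : fps R) : fps R :=
  fps_series (fun n => fpsC (fps_coef f n) * g ^+ n).

Lemma coef_fpsCM (R : comNzRingType) (c : R) (f : fps R) (n : nat) :
  fps_coef (fpsC c * f) n = c * fps_coef f n.
Proof.
rewrite coef_fpsM big_ord_recl /= subn0 big1 ?addr0 // => i _.
by rewrite /bump mul0r.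
Qed.

Lemma coef_fps_comp_Xn (R : comNzRingType) (f : fps R) (k m : nat) :
  (0 < k)%N ->
  fps_coef (fps_comp f (fpsX R ^+ k)) m =
    if (k %| m)%N then fps_coef f (m %/ k)%N else 0.
Proof.
move=> k_gt0; transitivity (\sum_(n < m.+1) fps_coef f n * (m == n * k)%N%:R).
  by apply: eq_bigr => n _; rewrite coef_fpsCM -exprM coef_fpsXn mulnC.
case: (boolP (k %| m)%N) => [/dvdnP[q ->] | ndvd].
  rewrite mulnK //.
  have qlt : (q < (q * k).+1)%N by rewrite ltnS leq_pmulr.
  rewrite (bigD1 (Ordinal qlt)) //= eqxx mulr1 big1 ?addr0 // => i ni.
  rewrite eqn_pmul2r // eq_sym.
  suff /negPf-> : (i : nat) != q by rewrite mulr0.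
  by apply: contra ni => /eqP iq; apply/eqP/val_inj.
rewrite big1 // => i _; case: eqP => [mE|]; last by rewrite mulr0.
by case/negP: ndvd; rewrite mE dvdn_mull.
Qed.

Definition F : fps 'F_2 :=
  fps_series (fun n => if (0 < n)%N && odd n then fpsX _ ^+ (n ^ 2) else 0).

Definition G : fps 'F_2 := fps_comp F (fpsX _ ^+ 3).

Definition D : fps 'F_2 :=
  fps_series (fun n =>
    if (0 < n)%N && coprime n 6 then fpsX _ ^+ (n ^ 2) else 0).

(* Main.v *)
(* The coefficient of x^N in FG counts modulo 2 the pairs (a, b) of odd positive
   integers with a^2 + 3 b^2 = N. Multiplying (a + b sqrt(-3)) / 2 by the cube
   root of unity that keeps both coordinates odd, and then taking absolute
   values, is an involution of these pairs. Its fixed points are a = b, where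
   N = 4 b^2, and a = 3 b, where N = 12 b^2; these are counted by F^4 and G^4,
   because f^4 = f(x^4) over F_2. This is (a). For (b), let H = F(x^9), so that
   D = F + H. Adding (a) to its image under x -> x^3 gives
   F^4 + H^4 = (F + H) G, that is D^4 = D G, and D can be cancelled. *)

Require Import Defs.
From mathcomp Require Import all_boot all_order all_algebra.
From mathcomp Require Import zify ring.
Local Open Scope ring_scope.
Import GRing.Theory.

Set Implicit Arguments.
Unset Strict Implicit.
Unset Printing Implicit Defensive.

(** * Cancellation modulo 2 by involutions *)

Lemma addrr_F2 (x : 'F_2) : x + x = 0.
Proof. by rewrite -mulr2n -mulr_natr pchar_Zp ?mulr0. Qed.

(** Points of [A] moved by [s] come in pairs with equal values of [g], and such a pair sums to zero
    in characteristic 2. *)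
Lemma sum_involution_F2 (T : finType) (A : pred T) (s : T -> T)
    (g : T -> 'F_2) :
    (forall x, A x -> A (s x)) -> (forall x, A x -> s (s x) = x) ->
    (forall x, A x -> g (s x) = g x) ->
  \sum_(x | A x) g x = \sum_(x | A x && (s x == x)) g x.
Proof.
move=> As sK gs; rewrite (bigID (fun x => s x == x)) /=.
rewrite -[RHS]addr0; congr (_ + _).
(* Of each two-point orbit, [u] takes the point of smaller rank and [v] the other; [s] exchanges the
   two halves. *)
rewrite (bigID (fun x => (enum_rank x < enum_rank (s x))%N)) /=.
set u := \sum_(i | _) _; set v := \sum_(i | _) _.
suff -> : v = u by rewrite addrr_F2.
rewrite {}/u {}/v (reindex_onto s s) /=; last by move=> x /andP[/andP[/sK]].
have AsE x : s (s x) == x -> A (s x) = A x.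
  by move=> /eqP ssx; apply/idP/idP => [/As|/As//]; rewrite ssx.
apply: eq_big => [x|x /andP[/andP[/andP[+ _] _] /eqP ssx]]; last first.
  by move=> /As; rewrite ssx => /gs.
have [/eqP ssx|nssx] := boolP (s (s x) == x); last first.
  rewrite andbF; apply/esym/negP => /andP[/andP[/sK /eqP]].
  by rewrite (negPf nssx).
rewrite AsE ssx ?eqxx // andbT -leqNgt (eq_sym x).
case: (A x) => //=; have [//|nsx] := eqVneq (s x) x => /=.
rewrite [RHS]ltn_neqAle; case: eqP => // /ord_inj/enum_rank_inj e.
by rewrite -e eqxx in nsx.
Qed.

Lemma sum_multiples (V : nmodType) (k q : nat) (h : nat -> V) : (0 < k)%N ->
  \sum_(i < (k * q).+1) (if (k %| i)%N then h (i %/ k)%N else 0) =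
  \sum_(j < q.+1) h j.
Proof.
move=> k0; elim: q => [|q IH]; first by rewrite muln0 !big_ord1 div0n dvdn0.
rewrite [RHS]big_ord_recr -IH /=.
have -> : ((k * q.+1).+1 = (k * q).+1 + k)%N by rewrite mulnS addnC.
rewrite big_split_ord /=; congr (_ + _).
case: k k0 {IH} => // k _; rewrite big_ord_recr /= big1 => [|i _].
  by rewrite add0r addSnnS -mulnSr dvdn_mulr // mulKn.
by rewrite addSnnS dvdn_addr ?dvdn_mulr // gtnNdvd // ltnS ltn_ord.
Qed.

(** * Substitution of x^k and the Frobenius map *)

Lemma fps_compXnD (R : comNzRingType) (k : nat) (f g : fps R) : (0 < k)%N ->
  fps_comp (f + g) (fpsX R ^+ k) =
  fps_comp f (fpsX R ^+ k) + fps_comp g (fpsX R ^+ k).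
Proof.
move=> k0; apply: fpsP => n; rewrite coef_fpsD !coef_fps_comp_Xn // coef_fpsD.
by case: ifP; rewrite ?addr0.
Qed.

(** A product of coefficients at i and n - i survives only if k divides both, so the convolution
    vanishes unless k divides n, and otherwise reduces to the one at n / k. *)
Lemma fps_compXnM (R : comNzRingType) (k : nat) (f g : fps R) : (0 < k)%N ->
  fps_comp (f * g) (fpsX R ^+ k) =
  fps_comp f (fpsX R ^+ k) * fps_comp g (fpsX R ^+ k).
Proof.
move=> k0; apply: fpsP => n; rewrite coef_fps_comp_Xn // [RHS]coef_fpsM.
case: (boolP (k %| n)%N) => [/dvdnP[q ->]|nkn]; last first.
  rewrite big1 // => i _; rewrite !coef_fps_comp_Xn //.
  case: ifP => [ki|]; last by rewrite mul0r.
  by rewrite dvdn_subl ?(negPf nkn) ?mulr0 // -ltnS.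
rewrite [(q * k)%N]mulnC mulKn // coef_fpsM -(sum_multiples _ (fun j =>
  fps_coef f j * fps_coef g (q - j)%N) k0).
apply: eq_bigr => i _; rewrite !coef_fps_comp_Xn //.
case: ifP => [ki|]; last by rewrite mul0r.
have i_le : (i <= k * q)%N by rewrite -ltnS.
rewrite dvdn_subr ?dvdn_mulr // ki; congr (_ * fps_coef g _).
by case/dvdnP: ki => j ->; rewrite mulnK // [(k * q)%N]mulnC -mulnBl mulnK.
Qed.

Lemma fps_compXnX (R : comNzRingType) (k l : nat) (f : fps R) :
  (0 < k)%N -> (0 < l)%N ->
  fps_comp (fps_comp f (fpsX R ^+ k)) (fpsX R ^+ l) =
  fps_comp f (fpsX R ^+ (k * l)).
Proof.
move=> k0 l0; apply: fpsP => n; rewrite !coef_fps_comp_Xn ?muln_gt0 ?k0 //.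
have [/dvdnP[q ->]|nl] := boolP (l %| n)%N.
  by rewrite mulnK // dvdn_pmul2r // divnMr.
case: ifP => // kl; case/negP: nl; apply: dvdn_trans kl; exact: dvdn_mull.
Qed.

(** The involution i -> n - i of the convolution leaves only the middle term i = n / 2, where c c =
    c in ['F_2]. *)
Lemma fps_sqr_F2 (f : fps 'F_2) : f ^+ 2 = fps_comp f (fpsX _ ^+ 2).
Proof.
apply: fpsP => n; rewrite coef_fps_comp_Xn // expr2 coef_fpsM.
have ordE (i : 'I_n.+1) : (i <= n)%N by rewrite -ltnS.
rewrite (@sum_involution_F2 _ _ (@rev_ord n.+1)) //=; first last.
- by move=> i _; rewrite subSS subKn // mulrC.
- by move=> i _; rewrite rev_ordK.
have [/dvdnP[q nE]|n2] := boolP (2 %| n)%N.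
  have -> : (n %/ 2 = q)%N by lia.
  have qn : (q < n.+1)%N by lia.
  rewrite (big_pred1 (Ordinal qn)) => [|i] /=.
    have -> : (n - q = q)%N by lia.
    by case: (fps_coef f q) => -[|[|//]] ?; apply: val_inj.
  by rewrite -!val_eqE /=; have := ordE i; lia.
by rewrite big1 // => i; rewrite -val_eqE /= => /eqP iE; have := ordE i; lia.
Qed.

Lemma fps_pow4_F2 (f : fps 'F_2) : f ^+ 4 = fps_comp f (fpsX _ ^+ 4).
Proof.
by rewrite (exprM f 2 2) [LHS]fps_sqr_F2 (fps_sqr_F2 f) fps_compXnX.
Qed.

(** The coefficient of x^(n+1) in f g is that of x^n in g plus terms in earlier coefficients of g,
    which vanish by strong induction. *)
Lemma fps_mul_eq0_ord1 (R : comNzRingType) (f g : fps R) :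
  fps_coef f 0 = 0 -> fps_coef f 1 = 1 -> f * g = 0 -> g = 0.
Proof.
move=> f0 f1 fg; apply: fpsP => n; elim/ltn_ind: n => n IH.
have := congr1 (fun h => fps_coef h n.+1) fg.
rewrite coef_fpsM big_ord_recl f0 mul0r add0r big_ord_recl.
rewrite f1 mul1r subSS subn0 big1 ?addr0 // => i _.
by rewrite /= /bump /= !add1n subSS IH ?mulr0 //; have := ltn_ord i; lia.
Qed.

(** * Coefficients of series over squares *)

Lemma coef_square_series (R : comNzRingType) (P : pred nat) (K m : nat) :
  (m < K)%N ->
  fps_coef (fps_series (fun n => if P n then fpsX R ^+ (n ^ 2) else 0)) m =
  \sum_(n < K | P n) (n ^ 2 == m)%N%:R.
Proof.
move=> mK; rewrite (fps_seriesP _ mK) => [|n i ni].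
  rewrite coef_fps_sum [RHS]big_mkcond; apply: eq_bigr => n _.
  by case: ifP => // _; rewrite coef_fpsXn eq_sym.
case: ifP => // _; rewrite coef_fpsXn; case: eqP => // iE.
by move: ni; rewrite iE ltnNge -mulnn; case: n {iE} => // n; rewrite leq_pmull.
Qed.

Lemma coef_F (K m : nat) : (m < K)%N ->
  fps_coef F m = \sum_(n < K | odd n) (n ^ 2 == m)%N%:R.
Proof.
move=> mK; rewrite (coef_square_series _ _ mK); apply: eq_bigl => n.
by case: (n : nat).
Qed.

(** The free bound [K] lets coefficients of different series be sums over one index type. *)
Lemma coef_F_compXn (k K m : nat) : (0 < k)%N -> (m < K)%N ->
  fps_coef (fps_comp F (fpsX _ ^+ k)) m =
  \sum_(n < K | odd n) (k * n ^ 2 == m)%N%:R.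
Proof.
move=> k0 mK; rewrite coef_fps_comp_Xn //.
case: (boolP (k %| m)%N) => [/dvdnP[q mE]|km].
  rewrite mE mulnK // (@coef_F K) 1?(leq_ltn_trans _ mK) ?mE ?leq_pmulr //.
  by apply: eq_bigr => n _; rewrite mulnC eqn_pmul2r.
rewrite big1 // => n _; case: eqP => // mE.
by rewrite -mE dvdn_mulr in km.
Qed.

(** The odd multiples n = 3 j contribute x^(9 j^2), which makes up F(x^9); in characteristic 2,
    adding this to [F] removes them. *)
Lemma D_eq : D = F + fps_comp F (fpsX _ ^+ 9).
Proof.
apply: fpsP => m; rewrite coef_fpsD.
(* With this bound the multiples 3 j in range are those with j <= m, as [sum_multiples] expects. *)
have mK : (m < (3 * m).+1)%N by lia.
rewrite (coef_F_compXn _ (ltnSn m)) // (coef_square_series _ _ mK).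
rewrite (coef_F mK) [X in _ = X + _](bigID (fun n : 'I_ _ => 3 %| n)%N) /=.
set u := \sum_(i < _ | _ && (3 %| i)%N) _.
have -> : u = \sum_(n < m.+1 | odd n) (9 * n ^ 2 == m)%N%:R.
  rewrite [RHS]big_mkcond -(@sum_multiples _ 3 _ (fun n =>
    if odd n then (9 * n ^ 2 == m)%N%:R : 'F_2 else 0)) // /u big_mkcond.
  apply: eq_bigr => i _; rewrite andbC; case: ifP => [/andP[/dvdnP[j ->] oj]|].
    rewrite dvdn_mull // mulnK //; move: oj; rewrite oddM andbT => ->.
    by rewrite expnMn mulnC.
  case: ifP => //= /dvdnP[j ->]; rewrite mulnK // oddM andbT => -> //.
rewrite addrAC addrr_F2 add0r; apply: eq_bigl => n.
have -> : (6 = 2 * 3)%N by [].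
rewrite coprimeMr coprimen2 [coprime n 3]coprime_sym prime_coprime //.
by case: (n : nat).
Qed.

(** * The involution on pairs of odd numbers *)

Local Open Scope nat_scope.

(* Multiplication of (a + b sqrt(-3)) / 2 by a primitive cube root of unity, up
   to the signs of the coordinates; the sums of two truncated differences are
   absolute values. *)
Definition rot3 (p : nat * nat) : nat * nat :=
  let: (a, b) := p in
  if a == b %[mod 4] then (((a - 3 * b) + (3 * b - a)) %/ 2, (a + b) %/ 2)
  else ((a + 3 * b) %/ 2, ((a - b) + (b - a)) %/ 2).

(** In either branch the two numbers being halved are congruent to 2 modulo 4. *)
Lemma rot3_odd a b : odd a -> odd b ->
  odd (rot3 (a, b)).1 && odd (rot3 (a, b)).2.
Proof. rewrite /rot3; case: ifP => /= /eqP; lia. Qed.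

(** Let z = (a + b sqrt(-3)) / 2 and let w be a primitive cube root of unity. Written over 2,
    exactly one of z, w z, w^2 z has even coordinates; the map swaps the other two, up to signs. *)
Lemma rot3K a b : odd a -> odd b -> rot3 (rot3 (a, b)) = (a, b).
Proof.
move=> oa ob; rewrite {2}/rot3.
case: ifP => /eqP ab /=; case: ifP => /eqP /= ?; congr (_, _); lia.
Qed.

(** Both sides are four times a norm, and a cube root of unity has norm 1. *)
Lemma rot3_norm a b : odd a -> odd b ->
  (rot3 (a, b)).1 ^ 2 + 3 * (rot3 (a, b)).2 ^ 2 = a ^ 2 + 3 * b ^ 2.
Proof.
move=> oa ob; rewrite /rot3; case: ifP => /eqP ab /=.
  set c := (X in X ^ 2 + _); set d := (X in _ + 3 * X ^ 2).
  (* Each case expresses everything through two natural numbers, without subtraction or halving, so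
     that a polynomial identity remains. *)
  have [[aE dE]|[[e [aE bE dE]]|[e [bE cE dE]]]] :
     (a = 3 * b + c + c /\ d = 2 * b + c)
     \/ (exists e, [/\ a = c + 3 * e, b = c + e & d = c + 2 * e])
     \/ (exists e, [/\ b = a + 2 * e, c = a + 3 * e & d = a + e]).
  - have [ba|ab'] := leqP (3 * b) a; first by left; rewrite /c /d; lia.
    by right; case: (leqP b d) => bd;
      [left; exists (d - b) | right; exists (b - d)];
      move: bd; rewrite /c /d => bd; split; lia.
  - by rewrite aE dE; ring.
  - by rewrite aE bE dE; ring.
  - by rewrite bE cE dE; ring.
set c := (X in X ^ 2 + _); set d := (X in _ + 3 * X ^ 2).
have [[aE dE]|[aE dE]] : (a = b + d + d /\ c = 2 * b + d)
     \/ (b = a + d + d /\ c = 2 * a + 3 * d) by rewrite /c /d; lia.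
  rewrite aE dE; ring.
rewrite aE dE; ring.
Qed.

Lemma rot3_fix a b : odd a -> odd b ->
  (rot3 (a, b) == (a, b)) = (a == b) || (a == 3 * b).
Proof.
move=> oa ob; rewrite /rot3; case: ifP => /eqP ab; rewrite xpair_eqE; lia.
Qed.

Arguments rot3 : simpl never.

(** * Counting pairs: the relation between F and G *)

Local Open Scope ring_scope.

Lemma coef_FG (K N : nat) : (N < K)%N ->
  fps_coef (F * G) N =
  \sum_(p : 'I_K * 'I_K |
    [&& odd p.1, odd p.2 & (p.1 ^ 2 + 3 * p.2 ^ 2 == N)%N]) 1.
Proof.
move=> NK; rewrite coef_fpsM.
transitivity (\sum_(i < N.+1) \sum_(a < K | odd a) \sum_(b < K | odd b)
  ((a ^ 2 == i)%N && (3 * b ^ 2 == N - i)%N)%:R : 'F_2).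
  apply: eq_bigr => i _.
  rewrite (@coef_F K) 1?(leq_ltn_trans _ NK) -1?ltnS //.
  rewrite (@coef_F_compXn 3 K) 1?(leq_ltn_trans _ NK) ?leq_subr //.
  rewrite mulr_suml; apply: eq_bigr => a _.
  rewrite mulr_sumr; apply: eq_bigr => b _.
  by rewrite -natrM mulnb.
rewrite exchange_big /=.
under eq_bigr do rewrite exchange_big /=.
rewrite pair_big /= [RHS]big_mkcond [LHS]big_mkcond.
apply: eq_bigr => -[a b] _ /=; case: (odd a) => //=; case: (odd b) => //=.
have [abN|abN] := eqVneq (a ^ 2 + 3 * b ^ 2)%N N; last first.
  rewrite big1 // => i _; case: eqP => //= ai; case: eqP => //= bi.
  by case/eqP: abN; have := ltn_ord i; rewrite ai bi ltnS; lia.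
have aN : (a ^ 2 < N.+1)%N by lia.
rewrite (bigD1 (Ordinal aN)) //= eqxx big1 => [|i].
  have -> : (3 * b ^ 2 == N - a ^ 2)%N by lia.
  by rewrite addr0.
by rewrite -val_eqE /= eq_sym => /negPf->.
Qed.

Lemma F_G_relation : F ^+ 4 + F * G + G ^+ 4 = 0.
Proof.
rewrite (fps_pow4_F2 F) (fps_pow4_F2 G) fps_compXnX //.
apply: fpsP => N; rewrite 2!coef_fpsD coef_fps0.
have NK : (N < N.+1)%N by []; pose K := N.+1.
rewrite [X in X + _ + _](@coef_F_compXn 4 K N isT NK).
rewrite [X in _ + X](@coef_F_compXn (3 * 4) K N isT NK) (coef_FG NK) -/K.
pose A (p : 'I_K * 'I_K) :=
  [&& odd p.1, odd p.2 & (p.1 ^ 2 + 3 * p.2 ^ 2 == N)%N].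
pose v (p : 'I_K * 'I_K) : nat * nat := (p.1 : nat, p.2 : nat).
(* [inord] sends out-of-range values to 0, but none occur on [A]: a coordinate is at most its
   square, hence at most [N]. *)
pose s (p : 'I_K * 'I_K) : 'I_K * 'I_K :=
  (inord (rot3 (v p)).1, inord (rot3 (v p)).2).
have vI : injective v.
  by move=> [a b] [c d] [/ord_inj-> /ord_inj->].
have vs p : A p -> v (s p) = rot3 (v p).
  case: p => a b /and3P[/= oa ob /eqP nE]; rewrite /v /s /=.
  have := rot3_norm oa ob; rewrite nE.
  case: (rot3 _) => c d /= cdN.
  have sq_ge n : (n <= n ^ 2)%N.
    by rewrite -mulnn; case: n => // n; exact: leq_pmull.
  have := sq_ge c; have := sq_ge d => dd cc.
  by rewrite !inordK //; lia.
have As p : A p -> A (s p).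
  move=> Ap; have := vs _ Ap; case: (s p) => c d.
  case: p Ap => a b /and3P[/= oa ob nE] cdE.
  have := rot3_norm oa ob; have := rot3_odd oa ob.
  by rewrite -[rot3 _]cdE /A /= => /andP[-> ->] ->.
have sK p : A p -> s (s p) = p.
  move=> Ap; apply: vI; rewrite vs ?As // vs //.
  by case: p Ap => a b /and3P[/= oa ob _]; rewrite rot3K.
rewrite (@sum_involution_F2 _ A s) //.
have fixE p : A p && (s p == p) =
    A p && (p.1 == p.2 :> nat) || A p && (p.1 == 3 * p.2 :> nat)%N.
  rewrite -andb_orr; apply: andb_id2l => Ap; rewrite -(inj_eq vI) vs //.
  by case: p Ap => a b /and3P[/= oa ob _]; rewrite rot3_fix.
rewrite (eq_bigl _ _ fixE) (bigID (fun p : 'I_K * 'I_K => p.1 == p.2)) /=.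
set S1 := \sum_(i | _ && (_ == _)) _; set S2 := \sum_(i | _ && (_ != _)) _.
have -> : S1 = \sum_(n < K | odd n) (4 * n ^ 2 == N)%N%:R.
  rewrite {}/S1 [RHS](eq_bigr (fun n : 'I_K =>
    if (4 * n ^ 2 == N)%N then 1 else 0)) => [|n _]; last by case: eqP.
  rewrite -big_mkcondr (reindex_onto (fun n : 'I_K => (n, n)) fst) /=.
    apply: eq_bigl => n; rewrite /A /= !eqxx andbT; lia.
  by case=> a b /= /andP[_ /eqP->].
have -> : S2 = \sum_(n < K | odd n) (3 * 4 * n ^ 2 == N)%N%:R.
  rewrite {}/S2 [RHS](eq_bigr (fun n : 'I_K =>
    if (3 * 4 * n ^ 2 == N)%N then 1 else 0)) => [|n _]; last by case: eqP.
  rewrite -big_mkcondr.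
  rewrite (reindex_onto (fun n : 'I_K => (inord (3 * n), n)) snd) /=.
    apply: eq_bigl => n; rewrite eqxx andbT -val_eqE /A /=.
    (* If 3 n is out of range, both conditions fail: [inord (3 * n)] differs from 3 n, and 12 n^2 >=
       3 n > N. *)
    have [nN|nN] := leqP K (3 * n).
      have -> : (3 * 4 * n ^ 2 == N)%N = false by apply/eqP; nia.
      rewrite andbF; have := ltn_ord (inord (3 * n) : 'I_K).
      set c := nat_of_ord (inord _) => cK; lia.
    by rewrite inordK //; lia.
  case=> a b /= /andP[/orP[] /andP[_ /eqP ab]].
    by move/eqP: ab; rewrite val_eqE => ->.
  by move=> _; congr (_, _); apply: val_inj; rewrite /= -ab inordK // ltn_ord.
by rewrite addrA addrr_F2 add0r addrr_F2.
Qed.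

Theorem theorem2p9 :
  F ^+ 4 + F * G + G ^+ 4 = 0 /\ D ^+ 3 = G.
Proof.
split; first exact: F_G_relation.
have addff (f : fps 'F_2) : f + f = 0.
  by apply: fpsP => n; rewrite coef_fpsD addrr_F2.
pose sub3 (f : fps 'F_2) := fps_comp f (fpsX _ ^+ 3).
have sub3_relation f g :
    sub3 (f ^+ 4 + f * g + g ^+ 4) =
    sub3 f ^+ 4 + sub3 f * sub3 g + sub3 g ^+ 4.
  have sub3M f1 f2 : sub3 (f1 * f2) = sub3 f1 * sub3 f2 by apply: fps_compXnM.
  have sub3D f1 f2 : sub3 (f1 + f2) = sub3 f1 + sub3 f2 by apply: fps_compXnD.
  have sub3X4 f1 : sub3 (f1 ^+ 4) = sub3 f1 ^+ 4.
    by rewrite !(exprM _ 2 2) !expr2 !sub3M.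
  by rewrite 2!sub3D sub3M !sub3X4.
set H := fps_comp F (fpsX _ ^+ 9).
(* The substitution x -> x^3 sends [F] to [G] and [G] to [H]. *)
have GH : G ^+ 4 + G * H + H ^+ 4 = 0.
  have <- : sub3 G = H by apply: fps_compXnX.
  apply: etrans (esym (sub3_relation F G)) _; rewrite F_G_relation.
  by apply: fpsP => n; rewrite coef_fps_comp_Xn //; case: ifP.
have DG (f g h : fps 'F_2) : f ^+ 4 + f * g + g ^+ 4 = 0 ->
    g ^+ 4 + g * h + h ^+ 4 = 0 -> (f + h) * ((f + h) ^+ 3 + g) = 0.
  move=> fg gh; rewrite mulrDr -exprS.
  have -> : (f + h) ^+ 4 = f ^+ 4 + h ^+ 4.
    rewrite (fps_pow4_F2 (f + h)) (fps_pow4_F2 f) (fps_pow4_F2 h).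
    exact: fps_compXnD.
  transitivity ((f ^+ 4 + f * g + g ^+ 4) + (g ^+ 4 + g * h + h ^+ 4)
                - (g ^+ 4 + g ^+ 4)); first by ring.
  by rewrite fg gh (addff (g ^+ 4)) addr0 subr0.
have {}DG : D * (D ^+ 3 + G) = 0.
  rewrite D_eq; exact: DG F_G_relation GH.
(* [D] begins with x, so it has order 1 and can be cancelled. *)
have D0 : fps_coef D 0 = 0 by rewrite /= big_ord1.
have D1 : fps_coef D 1 = 1.
  rewrite (coef_square_series _ _ (ltnSn 1)) big_mkcond !big_ord_recl big_ord0 /=.
  by rewrite add0r addr0.
have {DG} := fps_mul_eq0_ord1 D0 D1 DG; move: (D ^+ 3) G => f g fg.
by rewrite -[LHS]addr0 -(addff g) addrA fg add0r.
Qed.
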